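(* Let $f,g:\mathbb{N}\to\mathbb{N}$ be functions such that for every $k\in\mathbb{N}$ and every tree $G$ with pathwidth $k$ and maximum degree $3$, there is a tree $T$ with $\mathrm{pw}(T)\leq g(k)$ and there is a $T$-partition of $G$ with width at most $f(k)$. Then $g(k)\geq\lfloor k/2\rfloor$ for every $k\in\mathbb{N}$.
   Context: Here $\mathbb{N}=\{0,1,2,\dots\}$. Graphs are finite, simple and undirected. For a path $P$, a path-decomposition (or $P$-decomposition) of a graph $G$ is a collection $(B_x\subseteq V(G):x\in V(P))$ of subsets of $V(G)$ (called bags) indexed by the nodes of $P$ such that (a) for every edge $uv\in E(G)$ some bag contains both $u$ and $v$, and (b) for every vertex $v\in V(G)$ the set $\{x\in V(P):v\in B_x\}$ induces a non-empty connected subpath of $P$. Its width is the maximum size of a bag, minus $1$. The pathwidth $\mathrm{pw}(G)$ is the minimum width of a path-decomposition of $G$ (over all paths $P$). For a non-empty tree $T$, a $T$-partition of a graph $G$ is a partition $(B_x:x\in V(T))$ of $V(G)$ indexed by $V(T)$ (pairwise disjoint sets with union $V(G)$) such that for every edge $vw\in E(G)$, if $v\in B_x$ and $w\in B_y$, then $x=y$ or $xy\in E(T)$. The width of a $T$-partition is $\max\{|B_x|:x\in V(T)\}$. *)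

(* Defs.v *)
From mathcomp Require Import all_boot.
From mathcomp Require Import boolp.

Set Implicit Arguments.
Unset Strict Implicit.
Unset Printing Implicit Defensive.

Record sgraph := SGraph {
  vertex :> finType;
  edge : rel vertex;
  edge_sym : symmetric edge;
  edge_irrefl : irreflexive edge }.

Definition induced_connected (G : sgraph) (S : {set G}) : Prop :=
  {in S &, forall x y,
     connect [rel a b | [&& a \in S, b \in S & edge a b]] x y}.

(* In a simple graph, [ucycle] also accepts the empty sequence and the closed
   walks [:: x; y] along one edge; genuine cycles have at least 3 vertices. *)
Definition acyclic (G : sgraph) : Prop :=
  forall c : seq G, ucycle (@edge G) c -> size c < 3.

Definition is_tree (G : sgraph) : Prop :=
  [/\ 0 < #|G|, induced_connected [set: G] & acyclic G].

Definition degree (G : sgraph) (v : G) : nat := #|[set w | edge v w]|.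

Definition max_degree (G : sgraph) : nat := \max_(v : G) degree v.

Definition path_edge (n : nat) : rel 'I_n :=
  [rel i j : 'I_n | (i.+1 == j :> nat) || (j.+1 == i :> nat)].

Lemma path_edge_sym n : symmetric (@path_edge n).
Proof. by move=> i j; rewrite /path_edge /= orbC. Qed.

Lemma path_edge_irrefl n : irreflexive (@path_edge n).
Proof. by move=> i; rewrite /path_edge /= orbb eqn_leq ltnn. Qed.

Definition path_graph (n : nat) : sgraph :=
  SGraph (@path_edge_sym n) (@path_edge_irrefl n).

Definition path_decomposition (G : sgraph) (n : nat)
    (B : path_graph n -> {set G}) : Prop :=
  (forall u v : G, edge u v -> exists x, (u \in B x) && (v \in B x)) /\
  (forall v : G, [set x | v \in B x] != set0 /\
                 induced_connected [set x | v \in B x]).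

(* The predecessor is truncated: the graph without vertices gets width 0
   rather than -1. *)
Definition decomposition_width (G : sgraph) (n : nat)
    (B : path_graph n -> {set G}) : nat :=
  (\max_(x : path_graph n) #|B x|).-1.

Definition has_path_decomposition_of_width (G : sgraph) (k : nat) : Prop :=
  exists (n : nat) (B : path_graph n.+1 -> {set G}),
    path_decomposition B /\ decomposition_width B = k.

Lemma ex_path_decomposition (G : sgraph) :
  exists k, `[< has_path_decomposition_of_width G k >].
Proof.
pose B (x : path_graph 1) := [set: G].
exists (decomposition_width B); apply/asboolP; exists 0, B; split=> //.
split=> [u v _|v]; first by exists ord0; rewrite !inE.
split; first by apply/set0Pn; exists ord0; rewrite !inE.
by move=> x y _ _; rewrite (ord1 x) (ord1 y).
Qed.

Definition pathwidth (G : sgraph) : nat := ex_minn (ex_path_decomposition G).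

(* Parts may be empty. *)
Definition tree_partition (G T : sgraph) (B : T -> {set G}) : Prop :=
  [/\ forall x y : T, x != y -> [disjoint B x & B y],
      \bigcup_(x : T) B x = [set: G]
    & forall (v w : G) (x y : T),
        edge v w -> v \in B x -> w \in B y -> x = y \/ edge x y].

Definition partition_width (G T : sgraph) (B : T -> {set G}) : nat :=
  \max_(x : T) #|B x|.

(* Main.v *)
Require Import Defs.
From mathcomp Require Import all_boot.
From mathcomp Require Import boolp zify.

(* The argument compares growth rates. Let [G] be the tree of all binary words
   of length at most [k * n] with fewer than [k] letters [true]. It has maximum
   degree 3 and pathwidth at most [k], at least [n ^ k] vertices, and only paths
   of length [O(k * n)]. Suppose [G] has a [T]-partition of width at most [c].
   Deleting from [G] the parts met by a path that runs from the leftmost to the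
   rightmost bag of a path-decomposition of [T] leaves [O(c * k * n)] components,
   each of which sees a decomposition of width one less. Hence [G] has
   [O(n ^ pw(T))] vertices, with a constant independent of [n], so that
   [pw(T) >= k] for large [n]. The trivial partition [T = G] shows that
   [pw(G) = k], and the hypothesis even gives [g k >= k] for [k >= 2]. *)

Set Implicit Arguments.
Unset Strict Implicit.
Unset Printing Implicit Defensive.

(** * Path-decompositions and intervals *)

Lemma pathwidthP (G : sgraph) :
  has_path_decomposition_of_width G (pathwidth G).
Proof. by rewrite /pathwidth; case: ex_minnP => m /asboolP. Qed.

Lemma pathwidth_min (G : sgraph) k :
  has_path_decomposition_of_width G k -> pathwidth G <= k.
Proof. by rewrite /pathwidth; case: ex_minnP => m _ + hk; apply; apply/asboolP. Qed.

Lemma leq_bag_pathwidth (T : sgraph) :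
  exists (n : nat) (A : path_graph n.+1 -> {set T}),
    path_decomposition A /\ forall i, #|A i| <= (pathwidth T).+1.
Proof.
have [n [A [hA hw]]] := pathwidthP T; exists n, A; split=> // i.
have := leq_bigmax (F := fun x : path_graph n.+1 => #|A x|) i.
by move: hw; rewrite /decomposition_width; lia.
Qed.

(** A walk in a path graph changes the index by one at a time, so it cannot jump over [i]. *)
Lemma connected_path_graph_interval n (I : {set path_graph n})
    (l i r : path_graph n) :
  induced_connected I -> l \in I -> r \in I -> l <= i <= r -> i \in I.
Proof.
move=> cI lI rI /andP[li ir].
have /connectP[p] := cI _ _ lI rI.
elim: p l lI li => [|y p IH] /= x xI xi.
  by move=> _ rx; rewrite rx in ir; have -> : i = x by apply: val_inj => /=; lia.
case/andP=> /and3P[_ yI exy] pp rp.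
have [yi|iy] := leqP y i; first exact: (IH y).
by have -> : i = x by apply: val_inj => /=; move: exy => /orP[] /eqP; lia.
Qed.

Lemma induced_connect_sym (G : sgraph) (S : {set G}) :
  connect_sym [rel a b | [&& a \in S, b \in S & edge a b]].
Proof.
by apply: sym_connect_sym => u v; rewrite /= andbCA edge_sym.
Qed.

Lemma path_graph_interval_connected n a b :
  induced_connected [set i : path_graph n | a <= i <= b].
Proof.
set I := [set i : path_graph n | _]; move=> x y.
wlog xy : x y / x <= y => [hw xI yI|xI].
  have [xy|yx] := leqP x y; first exact: hw.
  by rewrite induced_connect_sym; apply: hw => //; exact: ltnW.
case: y xy => m hm /= xm; rewrite inE /= => mI.
have aI : a <= m by move: xI; rewrite inE /=; lia.
elim: m hm xm {aI} mI => [|m IH] hm xm mI.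
  by have -> : x = Ordinal hm by apply: val_inj => /=; lia.
have [xm1|xm1] := eqVneq (nat_of_ord x) m.+1.
  by have -> : x = Ordinal hm by exact: val_inj.
have hm' : m < n by lia.
have mI' : a <= m <= b by move: xI; rewrite inE /=; lia.
apply: connect_trans (IH hm' _ mI') (connect1 _); first by lia.
by rewrite /= !inE /= mI mI' /path_edge /= eqxx.
Qed.

Lemma pathwidth_intervals (G : sgraph) (a b : G -> nat) k :
  (forall v, a v <= b v) ->
  (forall u v, edge u v -> exists i, (a u <= i <= b u) && (a v <= i <= b v)) ->
  (forall i, #|[set v | a v <= i <= b v]| <= k.+1) ->
  pathwidth G <= k.
Proof.
move=> ab eab ck; pose n := \max_v b v.
have bn v : b v < n.+1 by rewrite ltnS; apply: leq_bigmax.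
pose A (i : path_graph n.+1) := [set v | a v <= i <= b v].
apply: leq_trans (_ : decomposition_width A <= k); last first.
  have : \max_(x : path_graph n.+1) #|A x| <= k.+1 by apply/bigmax_leqP => i _; exact: ck.
  by rewrite /decomposition_width; lia.
apply: pathwidth_min; exists n, A; split=> //; split=> [u v /eab[i hi]|v].
  have hin : i < n.+1 by have := bn u; lia.
  by exists (Ordinal hin); rewrite !inE.
have -> : [set x | v \in A x] = [set i : path_graph n.+1 | a v <= i <= b v].
  by apply/setP=> i; rewrite !inE.
split; last exact: path_graph_interval_connected.
by apply/set0Pn; exists (Ordinal (bn v)); rewrite inE /= ab leqnn.
Qed.

(** * Connected components after a deletion *)

Lemma leq_card_bigcup (I T : finType) (J : {set I}) (F : I -> {set T}) m :
  (forall i, i \in J -> #|F i| <= m) -> #|\bigcup_(i in J) F i| <= #|J| * m.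
Proof.
move=> Fm; rewrite -sum_nat_const.
apply: leq_trans (_ : \sum_(i in J) #|F i| <= _); last exact: leq_sum.
elim/big_rec2: _ => [|i s A _ h]; first by rewrite cards0.
by rewrite (leq_trans (leq_card_setU _ _)) // leq_add2l.
Qed.

Definition component (G : sgraph) (S : {set G}) (u : G) : {set G} :=
  [set v in S | connect [rel a b | [&& a \in S, b \in S & edge a b]] u v].

Lemma component_connected (G : sgraph) (S : {set G}) u :
  u \in S -> induced_connected (component S u).
Proof.
move=> uS; suff h v : v \in component S u -> connect
    [rel a b | [&& a \in component S u, b \in component S u & edge a b]] u v.
  move=> v w hv hw; apply: connect_trans (h _ hw).
  by rewrite induced_connect_sym h.
rewrite inE => /andP[vS /connectP[p]].
elim/last_ind: p v vS => [|p y IH] v vS; first by move=> _ ->.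
rewrite rcons_path last_rcons => /andP[pp /and3P[zS yS ezy]] ->.
apply: connect_trans (IH _ zS pp erefl) (connect1 _).
have cz : connect [rel a b | [&& a \in S, b \in S & edge a b]] u (last u p).
  by apply/connectP; exists p.
rewrite /= !inE zS yS ezy cz !andbT /=.
by apply: connect_trans cz (connect1 _); rewrite /= zS yS.
Qed.

(** On a walk in [S] from [v] to [r], the vertex just before the first entry into [R] serves as [u].
    Counting neighbours of [R] thus bounds the number of components of [S :\: R]. *)
Lemma component_boundary (G : sgraph) (S R : {set G}) v r :
  induced_connected S -> v \in S -> v \notin R -> r \in S -> r \in R ->
  exists2 u, v \in component (S :\: R) u &
    (u \in S :\: R) && [exists x in R, edge x u].
Proof.
move=> cS vS vR rS rR; have /connectP[p] := cS _ _ vS rS.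
elim: p v vS vR => [|y p IH] v vS vR /=; first by move=> _ rv; rewrite -rv rR in vR.
case/andP=> /and3P[_ yS evy] pp rp.
have [yR|yR] := boolP (y \in R).
  exists v; first by rewrite !inE vS vR /= connect0.
  by rewrite inE vS vR /=; apply/existsP; exists y; rewrite yR edge_sym.
have [u hu hR] := IH y yS yR pp rp; exists u => //.
move: hu; rewrite !inE vS vR yS yR /= => cu.
by apply: connect_trans cu (connect1 _); rewrite /= !inE vS vR yS yR edge_sym.
Qed.

(** * Growth of quotients of bounded pathwidth *)

Section Growth.

Variables (G T : sgraph) (phi : G -> T) (n : nat) (A : path_graph n -> {set T}).
Variables (c d D : nat).
Hypothesis phi_edge : forall u v, edge u v -> phi u = phi v \/ edge (phi u) (phi v).
Hypothesis A_dec : path_decomposition A.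

Lemma common_bag u v : edge u v -> exists i, (phi u \in A i) && (phi v \in A i).
Proof.
move=> /phi_edge[->|]; last by case: A_dec => h _ /h.
by have [/set0Pn[i]] := A_dec.2 (phi v); rewrite inE => ? _; exists i; rewrite andbb.
Qed.

Lemma bag_interval (x : T) (l i r : path_graph n) :
  x \in A l -> x \in A r -> l <= i <= r -> x \in A i.
Proof.
move=> xl xr lir; have [_ cI] := A_dec.2 x.
by have := connected_path_graph_interval cI _ _ lir; rewrite !inE; apply.
Qed.

(** A discrete intermediate value argument: consecutive vertices share a bag [j]. If [j <= i],
    continue from the next vertex at [j]; otherwise [i] lies between two bags of [phi x]. *)
Lemma path_meets_bag x p (l i r : path_graph n) :
  path (@edge G) x p -> phi x \in A l -> phi (last x p) \in A r -> l <= i <= r ->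
  exists2 y, y \in x :: p & phi y \in A i.
Proof.
elim: p x l => [|y p IH] x l /=.
  by move=> _ xl xr lir; exists x; rewrite ?mem_head // (bag_interval xl xr).
case/andP=> exy pp xl pr lir; have [j /andP[xj yj]] := common_bag exy.
have [ji|ij] := leqP j i.
  have [z zp zi] := IH y j pp yj pr ltac:(lia).
  by exists z; rewrite // in_cons zp orbT.
exists x; first exact: mem_head.
by apply: bag_interval xl xj _; lia.
Qed.

Hypothesis phi_fiber : forall x, #|[set v | phi v == x]| <= c.
Hypothesis G_degree : forall v : G, degree v <= d.
Hypothesis G_path : forall (x : G) p, path (@edge G) x p -> uniq (x :: p) -> size p < D.

(** One level deletes at most [c * D] vertices. They have at most [c * D * d] neighbours, and these
    meet every remaining component. *)
Fixpoint growth p := if p is p'.+1 then c * D * (1 + d * growth p') else c.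

(* Deleting the fibres over a path of [S] that joins the leftmost to the
   rightmost bag met by [S] removes a node from every bag met by [S]. *)
Lemma card_growth p (S : {set G}) :
  induced_connected S -> (forall i, #|A i :&: phi @: S| <= p.+1) ->
  #|S| <= growth p.
Proof.
elim: p S => [|p IH] S cS wS.
  have [->|/set0Pn[v vS]] := eqVneq S set0; first by rewrite cards0.
  apply: leq_trans (phi_fiber (phi v)); apply: subset_leq_card.
  apply/subsetP=> u uS; rewrite inE.
  (* Each bag holds at most one node of [phi @: S], and the images of adjacent vertices share a bag,
     so [phi] is constant along the walk. *)
  have /connectP[q] := cS _ _ vS uS.
  elim: q v vS => [|y q IHq] v vS /=; first by move=> _ ->.
  case/andP=> /and3P[_ yS evy] pq uq; rewrite (eqP (IHq y yS pq uq)).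
  have [i /andP[vi yi]] := common_bag evy.
  have /card_le1_eqP h := wS i.
  by apply/eqP; apply: h; rewrite inE ?vi ?yi imset_f.
have [->|/set0Pn[v0 v0S]] := eqVneq S set0; first by rewrite cards0.
pose met (i : path_graph n) := [exists v in S, phi v \in A i].
have metP v i : v \in S -> phi v \in A i -> met i.
  by move=> vS vi; apply/existsP; exists v; rewrite vS.
have [i0 m0] : exists i, met i.
  have [/set0Pn[i]] := A_dec.2 (phi v0); rewrite inE => hi _.
  by exists i; apply: metP hi.
pose idx (i : path_graph n) := nat_of_ord i.
case: (arg_minnP idx m0) => l /existsP[vl /andP[vlS vlA]] lmin.
case: (arg_maxnP idx m0) => r /existsP[vr /andP[vrS vrA]] rmax.
have /connectP[q0 pq0 eq0] := cS _ _ vlS vrS.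
case/shortenP: pq0 eq0 => q pq uq _ vrE.
have pq' : path (@edge G) vl q.
  by apply: sub_path pq => x y /=; case/and3P.
pose Q := [set x in map phi (vl :: q)]; pose R := [set v | phi v \in Q].
have cQ : #|Q| <= D.
  have -> : #|Q| = #|map phi (vl :: q)| by apply: eq_card => x; rewrite inE.
  by rewrite (leq_trans (card_size _)) // size_map /=; exact: G_path pq' uq.
have cR : #|R| <= c * D.
  have -> : R = \bigcup_(x in Q) [set v | phi v == x].
    apply/setP=> v; rewrite inE; apply/idP/bigcupP => [h|[x xQ]].
      by exists (phi v); rewrite // inE.
    by rewrite inE => /eqP->.
  apply: leq_trans (leq_card_bigcup (m := c) _) _ => //.
  by rewrite mulnC leq_mul2l cQ orbT.
have QA i : met i -> exists2 x, x \in Q & x \in A i.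
  move=> mi; have lir : l <= i <= r by apply/andP; split; [exact: lmin | exact: rmax].
  rewrite vrE in vrA; have [y yq yi] := path_meets_bag pq' vlA vrA lir.
  by exists (phi y); rewrite // inE map_f.
have QS : Q \subset phi @: S.
  apply/subsetP=> x; rewrite inE => /mapP[y yq ->]; apply: imset_f.
  move: yq; rewrite inE => /orP[/eqP->//|].
  elim: q vl pq {uq vrE pq' Q R cQ cR QA vlS vlA} => // z q IHq x' /=.
  by case/andP=> /and3P[_ zS _] /IHq h; rewrite inE => /orP[/eqP->|/h].
pose S' := S :\: R.
have wS' i : #|A i :&: phi @: S'| <= p.+1.
  have [mi|mi] := boolP (met i); last first.
    rewrite (_ : _ :&: _ = set0) ?cards0 //; apply/setP=> x; rewrite !inE.
    apply/negP=> /andP[xi /imsetP[v]]; rewrite inE => /andP[_ vS] xv.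
    by move/negP: mi; apply; apply: (metP v); rewrite -?xv.
  have [x xQ xi] := QA i mi.
  rewrite -ltnS; apply: leq_trans (wS i); apply: proper_card.
  apply/properP; split.
    by apply: setIS; apply: imsetS; exact: subsetDl.
  exists x; first by rewrite inE xi (subsetP QS).
  rewrite inE xi /=; apply/imsetP=> -[v]; rewrite !inE => /andP[/negP h _] xv.
  by apply: h; move: xQ; rewrite xv inE.
pose N := [set u in S' | [exists x in R, edge x u]].
have cN : #|N| <= c * D * d.
  apply: leq_trans (_ : #|\bigcup_(x in R) [set w | edge x w]| <= _).
    apply: subset_leq_card; apply/subsetP=> u; rewrite inE => /andP[_].
    by case/existsP=> x /andP[xR xu]; apply/bigcupP; exists x; last by rewrite inE.
  apply: leq_trans (leq_card_bigcup (m := d) _) _; last by rewrite leq_mul2r cR orbT.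
  by move=> x _; exact: G_degree.
have cS' : #|S'| <= c * D * d * growth p.
  apply: leq_trans (_ : #|\bigcup_(u in N) component S' u| <= _).
    apply: subset_leq_card; apply/subsetP=> v; rewrite inE => /andP[vR vS].
    have vlR : vl \in R by rewrite !inE /= eqxx.
    have [u hu uN] := component_boundary cS vS vR vlS vlR.
    by apply/bigcupP; exists u; first by rewrite inE.
  apply: leq_trans (leq_card_bigcup (m := growth p) _) _; last first.
    by rewrite leq_mul2r cN orbT.
  move=> u; rewrite inE => /andP[uS' _].
  apply: IH; first exact: component_connected.
  move=> i; apply: leq_trans (wS' i); apply: subset_leq_card.
  by apply: setIS; apply: imsetS; apply/subsetP=> v; rewrite inE => /andP[].
rewrite -(cardsID R S) /= mulnDr muln1 mulnA leq_add //.
by apply: leq_trans cR; apply: subset_leq_card; exact: subsetIr.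
Qed.

End Growth.

(** * Thinned binary trees *)

Section Words.

Variables k h : nat.

(* A vertex is the walk leading to it from the root [[::]], most recent step
   first: the parent of [b :: w] is [w]. *)
Definition thin_word := {w : {bseq h of bool} | count id w < k}.

Definition steps (u : thin_word) : seq bool := val (val u).

Lemma steps_inj : injective steps.
Proof. by move=> u v /val_inj /val_inj. Qed.

Lemma size_steps u : size (steps u) <= h.
Proof. exact: size_bseq. Qed.

Lemma count_steps u : count id (steps u) < k.
Proof. exact: (valP u). Qed.

Lemma ex_steps w : size w <= h -> count id w < k -> exists u, steps u = w.
Proof.
move=> hw ck.
by exists (Sub (Bseq hw : {bseq h of bool}) ck).
Qed.

Definition is_parent (v u : thin_word) :=
  [exists b : bool, steps u == b :: steps v].

Lemma is_parentP v u :
  reflect (exists b, steps u = b :: steps v) (is_parent v u).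
Proof.
by apply: (iffP existsP) => -[b /eqP e]; exists b => //; apply/eqP.
Qed.

Lemma size_parent v u : is_parent v u -> size (steps u) = (size (steps v)).+1.
Proof. by case/is_parentP=> b ->. Qed.

Lemma parent_inj u v w : is_parent v u -> is_parent w u -> v = w.
Proof.
by case/is_parentP=> b e /is_parentP[b']; rewrite e => -[_ /steps_inj].
Qed.

Definition thin_edge : rel thin_word := [rel u v | is_parent u v || is_parent v u].

Lemma thin_edge_sym : symmetric thin_edge.
Proof. by move=> u v; exact: orbC. Qed.

Lemma thin_edge_irrefl : irreflexive thin_edge.
Proof.
by move=> u; apply/negP=> /orP[] /size_parent; lia.
Qed.

Definition thin_tree : sgraph := SGraph thin_edge_sym thin_edge_irrefl.

Lemma thin_tree_connected : 0 < k -> induced_connected [set: thin_tree].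
Proof.
move=> k0; have [r rE] := @ex_steps [::] isT k0.
suff cr (u : thin_tree) : connect
    [rel a b | [&& a \in [set: thin_tree], b \in [set: thin_tree] & edge a b]] r u.
  move=> u v _ _; apply: connect_trans (cr v).
  by rewrite induced_connect_sym.
move: (size_steps u) (count_steps u); move e : (steps u) => w.
elim: w u e => [|b w IH] u e /= hw cw.
  by have -> : u = r by apply: steps_inj; rewrite rE.
have [|v vE] := @ex_steps w (ltnW hw); first by lia.
apply: connect_trans (IH v vE (ltnW hw) _) (connect1 _); first by lia.
rewrite /= !inE /=; apply/orP; left; apply/is_parentP.
by exists b; rewrite e vE.
Qed.

(** A deepest vertex of a cycle can only have its unique parent as a neighbour there, but a cycle of
    length at least 3 gives it two distinct neighbours. *)
Lemma thin_tree_acyclic : acyclic thin_tree.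
Proof.
move=> c uc; rewrite leqNgt; apply/negP=> c3.
have [x0 x0c] : exists x0, x0 \in c.
  by case: c c3 {uc} => // x0 c _; exists x0; exact: mem_head.
have [x xc xmax] : exists2 x, x \in c &
    forall y, y \in c -> size (steps y) <= size (steps x).
  case: (arg_maxnP (P := mem c) (fun y : thin_tree => size (steps y)) x0c) => x xc xm.
  by exists x.
have up y : y \in c -> edge x y -> is_parent y x.
  move=> yc /orP[/size_parent|//]; have := xmax y yc; lia.
case/rot_to: xc => i q rE.
have := uc; rewrite /ucycle -(rot_cycle i) -(rot_uniq i) rE.
have sq : 1 < size q by move: c3; rewrite -(size_rot i c) rE.
have qc : {subset q <= c}.
  by move=> y yq; rewrite -(mem_rot i) rE inE yq orbT.
case: q sq qc {rE} => // y q.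
case/lastP: q => // q z.
move=> _ qc /andP[] /=.
rewrite rcons_path last_rcons => /andP[exy /andP[_ ezx]].
case/and3P=> _ yq _.
have ez : edge x z by rewrite edge_sym.
have zq : z \in y :: rcons q z by rewrite inE mem_rcons mem_head orbT.
have e := parent_inj (up y (qc _ (mem_head _ _)) exy) (up z (qc _ zq) ez).
by move: yq; rewrite e mem_rcons mem_head.
Qed.

Lemma thin_tree_tree : 0 < k -> is_tree thin_tree.
Proof.
move=> k0; split; last exact: thin_tree_acyclic; last exact: thin_tree_connected.
by have [r _] := @ex_steps [::] isT k0; apply/card_gt0P; exists r.
Qed.

Lemma thin_tree_degree_le u : @degree thin_tree u <= 3.
Proof.
(* [None] is left for the parent of [u]; children are told apart by their last step. *)
pose code (v : thin_word) :=
  if is_parent u v then Some (head false (steps v)) else None.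
have -> : 3 = #|{: option bool}| by rewrite card_option card_bool.
rewrite /degree -(card_in_imset (f := code)) ?max_card // => v w.
rewrite !inE /code => ev ew.
case: ifP ev => [/is_parentP[b vE] _|nv pv].
  case: ifP ew => [/is_parentP[b' wE] _|//] [].
  by rewrite vE wE /= => eb; apply: steps_inj; rewrite vE wE eb.
case: ifP ew => // nw pw _.
case/orP: pv => [|pv]; rewrite ?nv //.
by case/orP: pw => [|/(parent_inj pv)]; rewrite ?nw.
Qed.

Lemma thin_tree_max_degree : 1 < k -> 1 < h -> max_degree thin_tree = 3.
Proof.
move=> k1 h1; apply/eqP; rewrite eqn_leq; apply/andP; split.
  by apply/bigmax_leqP => u _; exact: thin_tree_degree_le.
(* The child of [[:: false]] with a [true] step needs [1 < k], and depth 2 needs [1 < h]. *)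
have [u uE] := @ex_steps [:: false] (ltnW h1) (ltnW k1).
have [r rE] := @ex_steps [::] isT (ltnW k1).
have [v vE] := @ex_steps [:: true; false] h1 k1.
have [w wE] := @ex_steps [:: false; false] h1 (ltnW k1).
apply: leq_trans (_ : @degree thin_tree u <= _); last first.
  exact: (leq_bigmax (F := fun v : thin_tree => degree v)).
have -> : 3 = #|[set r; v; w]|.
  rewrite -setUA !cardsU1 cards1 !inE.
  have rv : r != v by apply/eqP=> e; move: rE; rewrite e vE.
  have rw : r != w by apply/eqP=> e; move: rE; rewrite e wE.
  have vw : v != w by apply/eqP=> e; move: vE; rewrite e wE.
  by rewrite (negbTE rv) (negbTE rw) (negbTE vw).
apply: subset_leq_card; apply/subsetP=> x; rewrite !inE => /orP[/orP[]|] /eqP->.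
- by apply/orP; right; apply/is_parentP; exists false; rewrite uE rE.
- by apply/orP; left; apply/is_parentP; exists true; rewrite uE vE.
- by apply/orP; left; apply/is_parentP; exists false; rewrite uE wE.
Qed.

(** Parents are unique, so a simple path that has gone down one edge never turns back up. *)
Lemma descending_path_size x (y : thin_tree) p :
  is_parent x y -> path (@edge thin_tree) y p -> uniq [:: x, y & p] ->
  size (steps y) + size p <= h.
Proof.
elim: p x y => [|z p IH] x y xy /=; first by rewrite addn0 size_steps.
case/andP=> /orP[yz|zy] pp; last first.
  by rewrite (parent_inj xy zy) !inE eqxx orbT.
move=> /andP[_ uq]; have := IH _ _ yz pp uq.
by rewrite (size_parent yz) addSnnS.
Qed.

(** A simple path first climbs, at most [size (steps x)] times, and then only descends. *)
Lemma thin_path_size (x : thin_tree) p :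
  path (@edge thin_tree) x p -> uniq (x :: p) -> size p < h.*2.+1.
Proof.
suff H : path (@edge thin_tree) x p -> uniq (x :: p) -> size p <= size (steps x) + h.
  by move=> pp up; have := H pp up; have := size_steps x; lia.
elim: p x => [|y p IH] x //= /andP[/orP[xy|yx] pp] /andP[xp up].
  have := descending_path_size xy pp; rewrite /= xp up => /(_ isT).
  rewrite (size_parent xy); move: (size p) => m; lia.
have := IH y pp up; rewrite (size_parent yx); move: (size p) => m; lia.
Qed.

End Words.

(** * Pathwidth of thinned binary trees *)

(* Rank, in the preorder that visits the [true]-subtree before the
   [false]-subtree, of a node of the complete binary tree of height [h], given
   by the walk from the root to it, first step first. *)
Fixpoint preorder h (w : seq bool) : nat :=
  if w is b :: w' then (if b then 1 else 2 ^ h) + preorder h.-1 w' else 0.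

(** The rank of the [false]-child of [w], if there is one: [w] and its [true]-subtree occupy
    [2 ^ (h - size w)] ranks. *)
Definition preorder_end h (w : seq bool) := preorder h w + 2 ^ (h - size w).

Lemma preorder_rcons h w b :
  preorder h (rcons w b) = preorder h w + (if b then 1 else 2 ^ (h - size w)).
Proof.
elim: w h => [|c w IH] h /=; first by rewrite subn0 addn0.
by rewrite IH addnA; congr (_ + if b then _ else 2 ^ _); lia.
Qed.

Lemma preorder_end_gt0 h w : 0 < preorder_end h w.
Proof. by rewrite /preorder_end addn_gt0 expn_gt0 orbT. Qed.

Lemma preorder_end_cons h b w :
  preorder_end h.+1 (b :: w) = (if b then 1 else 2 ^ h.+1) + preorder_end h w.
Proof. by rewrite /preorder_end /= addnA. Qed.

Lemma preorder_end_nil h : preorder_end h [::] = 2 ^ h.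
Proof. by rewrite /preorder_end /= subn0. Qed.

(** The complete tree of height [h] has [(2 ^ h.+1).-1] nodes, and for [size w < h] the
    [false]-child of [w] is one of them. *)
Lemma preorder_end_lt h w :
  size w < h -> preorder_end h w < (2 ^ h.+1).-1.
Proof.
elim: w h => [|b w IH] [|h] //= hw.
  by rewrite preorder_end_nil !expnS; have := expn_gt0 2 h; lia.
rewrite preorder_end_cons; have := IH h hw; rewrite (expnS 2 h.+1).
by case: b; have := expn_gt0 2 h.+1; lia.
Qed.

(** Distinct inner nodes have distinct [false]-children. Hence closing the half-open intervals adds
    at most one vertex to each bag. *)
Lemma preorder_end_inj h w w' :
  size w < h -> size w' < h -> preorder_end h w = preorder_end h w' -> w = w'.
Proof.
elim: h w w' => [|h IH] // [|b w] [|b' w'] //=; rewrite !ltnS => hw hw'.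
- rewrite preorder_end_cons preorder_end_nil.
  have := preorder_end_lt hw'; have := preorder_end_gt0 h w'; case: b'; lia.
- rewrite preorder_end_cons preorder_end_nil.
  have := preorder_end_lt hw; have := preorder_end_gt0 h w; case: b; lia.
- rewrite !preorder_end_cons => e.
  have eb : b = b'.
    have := preorder_end_lt hw; have := preorder_end_gt0 h w.
    have := preorder_end_lt hw'; have := preorder_end_gt0 h w'.
    by case: b b' e => -[]; lia.
  by rewrite eb in e *; congr (_ :: _); apply: IH hw hw' _; lia.
Qed.

(* The half-open interval of [w] consists of the ranks of [w] and of its
   [true]-subtree, so the walks whose intervals share a point form a chain in
   which the number of [true] steps strictly increases. *)
Lemma preorder_count_inj h i w w' :
  size w < h -> size w' < h ->
  preorder h w <= i < preorder_end h w -> preorder h w' <= i < preorder_end h w' ->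
  count id w = count id w' -> w = w'.
Proof.
elim: h i w w' => [|h IH] i // [|b w] [|b' w'] //=; rewrite !ltnS => hw hw'.
- rewrite preorder_end_cons preorder_end_nil.
  by case: b'; lia.
- rewrite preorder_end_cons preorder_end_nil.
  by case: b; lia.
- rewrite !preorder_end_cons => e e' ec.
  have := preorder_end_lt hw; have := preorder_end_lt hw' => l l'.
  have eb : b = b' by case: b b' e e' {ec} => -[]; lia.
  rewrite eb in e ec *; congr (_ :: _).
  apply: (IH (i - (if b' then 1 else 2 ^ h.+1)) _ _ hw hw'); lia.
Qed.

Lemma pathwidth_thin_tree k h : pathwidth (thin_tree k h) <= k.
Proof.
(* Height [h.+1] makes every vertex an inner node of the complete tree. The closed interval of [u]
   then contains the ranks of both children, the [false]-child sitting at its right end. *)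
pose a (u : thin_tree k h) := preorder h.+1 (rev (steps u)).
pose b (u : thin_tree k h) := preorder_end h.+1 (rev (steps u)).
have sz (u : thin_tree k h) : size (rev (steps u)) < h.+1.
  by rewrite size_rev ltnS size_steps.
have ab u : a u <= b u by exact: leq_addr.
have ap u v : is_parent u v -> a u <= a v <= b u.
  case/is_parentP=> c e; rewrite /a /b e rev_cons preorder_rcons /preorder_end.
  rewrite leq_addr leq_add2l /=; case: c {e} => //.
  by rewrite expn_gt0.
apply: (pathwidth_intervals ab) => [u v /orP[uv|vu]|i].
- by exists (a v); rewrite (ap _ _ uv) leqnn ab.
- by exists (a u); rewrite (ap _ _ vu) leqnn ab.
(* Intervals that continue past [i] are told apart by their number of [true] steps, which takes [k]
   values; [None] is for the one interval that may end at [i]. *)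
pose code (u : thin_tree k h) : option 'I_k :=
  if i < b u then Some (Ordinal (count_steps u)) else None.
have -> : k.+1 = #|{: option 'I_k}| by rewrite card_option card_ord.
rewrite -(card_in_imset (f := code)) ?max_card // => u v.
rewrite !inE /code => /andP[au ub] /andP[av vb].
case: ifP => [ui|/negbT iu]; case: ifP => [vi|/negbT iv] //.
  move=> [ec]; apply: steps_inj; apply: (can_inj revK).
  apply: (preorder_count_inj (i := i) (sz u) (sz v)).
  - exact/andP.
  - exact/andP.
  - by rewrite !count_rev.
move=> _; apply: steps_inj; apply: (can_inj revK).
apply: (preorder_end_inj (sz u) (sz v)); rewrite -/(b u) -/(b v).
by move: iu iv; rewrite -!leqNgt; lia.
Qed.

(** * Counting *)

(** Turns [k] numbers below [n] into a vertex: [k] blocks need only [k - 1] separators [true], and a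
    block with its separator has length at most [n], whence the height [k * n]. *)
Fixpoint gaps_word (s : seq nat) : seq bool :=
  if s is i :: s' then
    nseq i false ++ (if s' is [::] then [::] else true :: gaps_word s')
  else [::].

Lemma nseq_false_inj i j s t :
  ohead s != Some false -> ohead t != Some false ->
  nseq i false ++ s = nseq j false ++ t -> i = j /\ s = t.
Proof.
move=> hs ht; elim: i j => [|i IH] [|j] //=.
- by case: s hs => // -[].
- by case: t ht {IH} => // -[].
- by case=> /IH[-> ->].
Qed.

Lemma gaps_word_inj s t : size s = size t -> gaps_word s = gaps_word t -> s = t.
Proof.
elim: s t => [|i s IH] [|j t] //= [st].
case: s t st IH => [|i' s] [|j' t] // st IH e.
  by case: (nseq_false_inj _ _ e) => // ->.
by case: (nseq_false_inj _ _ e) => // -> [/(IH _ st) ->].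
Qed.

Lemma count_gaps_word s : count id (gaps_word s) = (size s).-1.
Proof.
elim: s => [|i s IH] //=; rewrite count_cat count_nseq mul0n add0n.
by case: s IH => //= j s ->.
Qed.

Lemma size_gaps_word n s :
  all (fun i => i < n) s -> size (gaps_word s) <= size s * n.
Proof.
elim: s => [|i s IH] //= /andP[lt_in /IH]; rewrite size_cat size_nseq mulSn.
by case: s {IH} => [|j s] /=; lia.
Qed.

Lemma card_thin_tree k n : 0 < k -> n ^ k <= #|thin_tree k (k * n)|.
Proof.
move=> k0; pose nats (t : k.-tuple 'I_n) := map val t.
have sz t : size (nats t) = k by rewrite size_map size_tuple.
have ok t : exists u : thin_tree k (k * n), steps u == gaps_word (nats t).
  have [||u uE] := @ex_steps k (k * n) (gaps_word (nats t)).
  - rewrite -[X in _ <= X * _](sz t); apply: size_gaps_word.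
    by apply/allP=> _ /mapP[i _ ->]; exact: ltn_ord.
  - by rewrite count_gaps_word sz; lia.
  - by exists u; apply/eqP.
rewrite -[X in X ^ _]card_ord -card_tuple.
rewrite -(card_imset (f := fun t => xchoose (ok t))) ?max_card // => s t e.
apply: val_inj; apply: (inj_map val_inj).
apply: gaps_word_inj; first by rewrite -/(nats s) -/(nats t) !sz.
by rewrite -/(nats s) -(eqP (xchooseP (ok s))) e (eqP (xchooseP (ok t))).
Qed.

(** As [d * growth c d D p] is positive, adding 1 at most doubles it, so each level costs a factor
    of at most [2 * c * d * D]. *)
Lemma growth_bound c d D p :
  0 < c -> 0 < d -> 0 < D -> growth c d D p <= c * (2 * c * d * D) ^ p.
Proof.
move=> c0 d0 D0; have g0 q : 0 < growth c d D q.
  by case: q => //= q; rewrite !muln_gt0 c0 D0.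
elim: p => [|p IH]; first by rewrite muln1.
rewrite expnS mulnCA; apply: leq_trans (leq_mul (leqnn _) IH).
rewrite [growth _ _ _ p.+1]/=.
have -> : 2 * c * d * D * growth c d D p = c * D * (2 * (d * growth c d D p)) by nia.
rewrite leq_mul2l; apply/orP; right.
have : 0 < d * growth c d D p by rewrite muln_gt0 d0 g0.
by lia.
Qed.

(* For [n] large, the fibre bound [c] forces the host graph to have the full
   pathwidth. *)
Lemma leq_pathwidth_quotient c k (c_gt0 : 0 < c) (k_gt0 : 0 < k) :
  exists n0, forall n, n0 < n -> forall (T : sgraph) (phi : thin_tree k (k * n) -> T),
    (forall u v, edge u v -> phi u = phi v \/ edge (phi u) (phi v)) ->
    (forall x, #|[set v | phi v == x]| <= c) -> k <= pathwidth T.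
Proof.
(* With degree 3 and [D = (k * n).*2.+1 <= 3 * k * n], the base in [growth_bound] is at most
   [C * n]. The threshold makes [c * (C * n) ^ k.-1] smaller than [n ^ k]. *)
pose C := 2 * c * 3 * (3 * k); exists (c * C ^ k) => n hn T phi pe pf.
have C0 : 0 < C by rewrite /C; lia.
have n0 : 0 < n by lia.
have [m [A [hA wA]]] := leq_bag_pathwidth T.
have cG : #|[set: thin_tree k (k * n)]| <= growth c 3 (k * n).*2.+1 (pathwidth T).
  apply: (card_growth pe hA pf (@thin_tree_degree_le _ _) (@thin_path_size _ _)).
    exact: thin_tree_connected.
  by move=> i; apply: leq_trans (wA i); apply: subset_leq_card; exact: subsetIl.
rewrite leqNgt; apply/negP=> lt_k.
have := card_thin_tree n k_gt0; rewrite -cardsT => /leq_trans/(_ cG).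
apply/negP; rewrite -ltnNge.
apply: leq_ltn_trans (growth_bound _ _ _ _) _ => //.
apply: leq_ltn_trans (_ : c * (C * n) ^ k.-1 < _).
  rewrite leq_mul2l; apply/orP; right.
  apply: leq_trans (_ : (C * n) ^ pathwidth T <= _); last first.
    by rewrite leq_pexp2l ?muln_gt0 ?C0 //; lia.
  case: (pathwidth T) => // q; rewrite leq_exp2r // /C -[leqRHS]mulnA leq_mul2l.
  have kn0 : 0 < k * n by rewrite muln_gt0 k_gt0.
  by apply/orP; right; lia.
rewrite expnMn mulnA; case: k k_gt0 @C hn C0 {pe pf cG lt_k phi} => // k _ C hn C0 /=.
rewrite (expnS n) ltn_mul2r expn_gt0 n0 /=.
apply: leq_ltn_trans hn; rewrite leq_mul2l; apply/orP; right.
by rewrite leq_pexp2l.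
Qed.

(** * Quotient maps of tree-partitions and the conclusion *)

Lemma partition_map (G T : sgraph) (B : T -> {set G}) :
  tree_partition B -> exists phi : G -> T,
    (forall u v, edge u v -> phi u = phi v \/ edge (phi u) (phi v)) /\
    forall x, #|[set v | phi v == x]| <= partition_width B.
Proof.
case=> _ cover_B edge_B.
have ex_part v : exists x, v \in B x.
  by have := in_setT v; rewrite -cover_B => /bigcupP[x _ vx]; exists x.
exists (fun v => xchoose (ex_part v)); split=> [u v uv|x].
  exact: edge_B uv (xchooseP (ex_part u)) (xchooseP (ex_part v)).
apply: (@leq_trans #|B x|); last exact: (leq_bigmax (F := fun x : T => #|B x|)).
apply: subset_leq_card.
by apply/subsetP=> v; rewrite inE => /eqP <-; exact: (xchooseP (ex_part v)).
Qed.

Theorem theorem4 (f g : nat -> nat)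
  (hfg : forall (k : nat) (G : sgraph),
     is_tree G -> pathwidth G = k -> max_degree G = 3 ->
     exists T : sgraph,
       [/\ is_tree T, pathwidth T <= g k
         & exists B : T -> {set G},
             tree_partition B /\ partition_width B <= f k]) :
  forall k : nat, k./2 <= g k.
Proof.
move=> k; have [k1|k1] := leqP k 1; first by case: k k1 => [|[]].
have k0 := ltnW k1.
(* The width bound [f k] depends on the pathwidth only, so [n] can be chosen after it; the successor
   makes it positive. *)
have [n0 hn] := leq_pathwidth_quotient (c := (f k).+1) isT k0.
pose n := n0.+2; have lt_n : n0 < n by rewrite /n; lia.
pose G := thin_tree k (k * n).
(* The identity has fibres of size 1, within the bound [(f k).+1], so the same [n] also serves for
   the lower bound here. *)
have pwG : pathwidth G = k.
  apply/eqP; rewrite eqn_leq pathwidth_thin_tree /=.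
  apply: (hn n lt_n G id) => [u v uv|x]; first by right.
  rewrite (_ : [set v | _] = [set x]) ?cards1 //.
  by apply/setP=> v; rewrite !inE.
have degG : max_degree G = 3 by apply: thin_tree_max_degree; rewrite /n; lia.
have [T [_ pwT [B [Bpart Bw]]]] := hfg _ _ (thin_tree_tree _ k0) pwG degG.
have [phi [pe pf]] := partition_map Bpart.
have kT : k <= pathwidth T.
  by apply: (hn n lt_n T phi pe) => x; apply: leq_trans (pf x) _; lia.
by rewrite leq_half_double; have := leq_trans kT pwT; lia.
Qed.
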